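(* Let $\Bbbk$ be a field of positive characteristic $p>2$ and let $X$ be an $m\times n$ generic matrix of indeterminates, where $m,n\geq 2$. Then: (1) the ring $\Bbbk[X]/\sqrt{P_2(X)}$ is $F$-pure; (2) the ring $\Bbbk[X]/\sqrt{P_2(X)}$ is $F$-regular if and only if $m=n=2$.
   Context: An $m\times n$ generic matrix of indeterminates is a matrix $X=(x_{ij})$ whose $mn$ entries are distinct indeterminates; $\Bbbk[X]$ is the polynomial ring over $\Bbbk$ in these indeterminates. The permanent of a $2\times 2$ matrix $\begin{pmatrix} a&b\\ c&d\end{pmatrix}$ is $ad+bc$. $P_2(X)$ denotes the ideal of $\Bbbk[X]$ generated by the permanents of all $2\times 2$ submatrices of $X$ (obtained by choosing two distinct rows and two distinct columns), and $\sqrt{P_2(X)}$ is its radical. Let $R$ be a quotient of a standard graded polynomial ring over a field of characteristic $p>0$ by a homogeneous ideal. For an ideal $J=(m_1,\dots,m_k)$ of $R$ and $q=p^e$ with $e$ a positive integer, $J^{[q]}=(m_1^q,\dots,m_k^q)$. The Frobenius closure $J^F$ is the set of $r\in R$ with $r^q\in J^{[q]}$ for some $q=p^e$. The tight closure $J^*$ is the set of $r\in R$ for which there is a non-zerodivisor $c$ of $R$ such that $cr^q\in J^{[q]}$ for all sufficiently large $q=p^e$. The ring $R$ is called $F$-pure if $J=J^F$ for every ideal $J$ of $R$, and $F$-regular if $J=J^*$ for every ideal $J$ of $R$. *)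

(* Defs.v *)
From HB Require Import structures.
From mathcomp Require Import all_boot all_order all_algebra.
From mathcomp Require Import boolp.
From mathcomp Require Import mpoly.

Set Implicit Arguments.
Unset Strict Implicit.
Unset Printing Implicit Defensive.

Import GRing.Theory.
Local Open Scope ring_scope.

Section Ideals.
Variable R : comNzRingType.
Implicit Types (s : seq R) (I : R -> Prop) (x : R).

Definition ideal_gen s x : Prop :=
  exists a : 'I_(size s) -> R, x = \sum_(i < size s) a i * s`_i.

Definition radical I x : Prop := exists2 d : nat, (0 < d)%N & I (x ^+ d).

Lemma ideal_gen0 s : ideal_gen s 0.
Proof. by exists (fun=> 0); rewrite big1 // => i _; rewrite mul0r. Qed.

Lemma ideal_genD s x y : ideal_gen s x -> ideal_gen s y -> ideal_gen s (x + y).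
Proof.
move=> [a ->] [b ->]; exists (fun i => a i + b i); rewrite -big_split /=.
by apply: eq_bigr => i _; rewrite mulrDl.
Qed.

Lemma ideal_genM s c x : ideal_gen s x -> ideal_gen s (c * x).
Proof.
move=> [a ->]; exists (fun i => c * a i); rewrite mulr_sumr.
by apply: eq_bigr => i _; rewrite mulrA.
Qed.

Lemma ideal_gen_sum s (J : Type) (r : seq J) (P : pred J) (F : J -> R) :
  (forall j, P j -> ideal_gen s (F j)) -> ideal_gen s (\sum_(j <- r | P j) F j).
Proof.
move=> sF; apply: (big_ind (ideal_gen s)) => //; first exact: ideal_gen0.
exact: ideal_genD.
Qed.

Lemma radical_gen0 s : radical (ideal_gen s) 0.
Proof. by exists 1%N => //; rewrite expr1; apply: ideal_gen0. Qed.

Lemma radical_genM s c x :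
  radical (ideal_gen s) x -> radical (ideal_gen s) (c * x).
Proof. by move=> [d d0 sx]; exists d; rewrite // exprMn; apply: ideal_genM. Qed.

Lemma radical_genD s x y : radical (ideal_gen s) x ->
  radical (ideal_gen s) y -> radical (ideal_gen s) (x + y).
Proof.
move=> [d d0 sx] [e e0 sy]; exists (d + e)%N; first by rewrite addn_gt0 d0.
rewrite exprDn; apply: ideal_gen_sum => i _; rewrite -mulr_natl.
apply: ideal_genM; case: i => /= i _; have [lt_ie|le_ei] := ltnP i e.
  have -> : (d + e - i = (e - i) + d)%N by rewrite addnC -addnBAC // ltnW.
  by rewrite exprD mulrAC; apply: ideal_genM.
by rewrite -(subnK le_ei) exprD mulrA; apply: ideal_genM.
Qed.

End Ideals.

(* Ideals are given by finite lists of generators, which reaches every ideal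
   of a Noetherian ring.  In this section p stands for the characteristic of R,
   and q = p ^ e with e > 0. *)
Section FrobeniusAndTightClosure.
Variables (p : nat) (R : comNzRingType).
Implicit Types (s : seq R) (x c : R).

Definition frobenius_power s (e : nat) : R -> Prop :=
  ideal_gen [seq g ^+ (p ^ e) | g <- s].

Definition frobenius_closure s x : Prop :=
  exists2 e : nat, (0 < e)%N & frobenius_power s e (x ^+ (p ^ e)).

(* [GRing.lreg c] says that c is a non-zerodivisor, as R is commutative. *)
Definition tight_closure s x : Prop :=
  exists2 c : R, GRing.lreg c &
    exists e0 : nat, forall e : nat, (0 < e)%N -> (e0 <= e)%N ->
      frobenius_power s e (c * x ^+ (p ^ e)).

Definition F_pure : Prop :=
  forall s x, ideal_gen s x <-> frobenius_closure s x.

Definition F_regular : Prop :=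
  forall s x, ideal_gen s x <-> tight_closure s x.

End FrobeniusAndTightClosure.

Definition permanent2 (R : comNzRingType) (A : 'M[R]_2) : R :=
  A 0 0 * A 1 1 + A 0 1 * A 1 0.

Section GenericMatrix.
Variables (k : fieldType) (m n : nat).

Definition generic_mx : 'M[{mpoly k[m * n]}]_(m, n) :=
  \matrix_(i, j) 'X_(mxvec_index i j).

(* The permanent is invariant under swapping rows or columns, so ordered pairs
   of distinct rows and columns cover all 2 x 2 submatrices. *)
Definition P2_gens : seq {mpoly k[m * n]} :=
  [seq permanent2 (mxsub (tnth [tuple i.1; i.2]) (tnth [tuple j.1; j.2])
                     generic_mx)
  | i <- enum [pred i : 'I_m * 'I_m | (i.1 < i.2)%N],
    j <- enum [pred j : 'I_n * 'I_n | (j.1 < j.2)%N]].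

Definition P2 : {mpoly k[m * n]} -> Prop := ideal_gen P2_gens.

(* A boolean predicate, by excluded middle, as [{ideal_quot _}] requires. *)
Definition rad_P2 : {pred {mpoly k[m * n]}} := [pred f | `[< radical P2 f >]].

Lemma P2_meval0 f : P2 f -> f.@[fun=> 0] = 0.
Proof.
move=> [a ->]; rewrite raddf_sum big1 // => i _; rewrite /= mevalM.
have /allpairsP[[u v] [_ _ ->]] : P2_gens`_i \in P2_gens by rewrite mem_nth.
by rewrite /permanent2 !mxE mevalD !mevalM !mevalXU !mul0r addr0 mulr0.
Qed.

Lemma rad_P2_idealr_closed : idealr_closed rad_P2.
Proof.
split.
- by apply/asboolP; apply: radical_gen0.
- apply/negP => /asboolP[d _]; rewrite expr1n => /P2_meval0/eqP.
  by rewrite meval1 oner_eq0.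
- move=> c x y /asboolP Ix /asboolP Iy; apply/asboolP.
  by apply: radical_genD => //; apply: radical_genM.
Qed.

HB.instance Definition _ :=
  isIdealr.Build {mpoly k[m * n]} rad_P2 rad_P2_idealr_closed.

Definition P2_quotient : comNzRingType := {ideal_quot rad_P2}.

End GenericMatrix.

(* Main.v *)
Require Import Defs.
From HB Require Import structures.
From mathcomp Require Import all_boot all_order all_algebra.
From mathcomp Require Import boolp.
From mathcomp Require Import mpoly.
From mathcomp Require Import zify.

Set Implicit Arguments.
Unset Strict Implicit.
Unset Printing Implicit Defensive.

Import GRing.Theory.
Local Open Scope ring_scope.

(** The idea is that the quotient Q of S = k[X] by the radical of P_2(X) is, up
to signs, glued from affine semigroup rings.  Let B = k[s_1..s_m, t_1..t_n].
Multiplying s_i t_j by signs whose 2 x 2 permanents all vanish, and putting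
zeros elsewhere, defines a homomorphism [pattern_mor e] : S -> B that kills
P_2(X), hence its radical as B is a domain.  The supports e are a 2 x 2
block, at least three cells of one row, or at least three cells of one column.

Give a monomial the row and column sums of its exponent matrix as its degree
([margins]).  Replacing x_ij x_i'j' by - x_ij' x_i'j shows that two monomials
of equal margins agree up to sign in Q ([same_margins]), so every graded piece
of Q is spanned by one monomial.  That monomial vanishes in Q when its support
meets at least two rows and three columns, or three rows and two columns: one
of its powers is then a multiple of a product w that an odd cycle of swaps
carries to - w, and 2 is invertible ([wide_support_eq0]).  Otherwise some
pattern does not kill it.  Hence an element of Q is zero as soon as all
[pattern_mor e] vanish on it ([proj_eq0P]).

F-purity.  From x^q = sum_i a_i g_i^q in Q one passes to B, where the operator
[cartier] extracts the coefficients at exponents congruent to a given alpha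
modulo q.  It turns the relation into F(x) = sum_i a'_i F(g_i), F being the
Frobenius of the coefficients alone ([cartierM]); margins that are divisible
by q come from monomials v^q up to sign, which keeps a'_i inside Q, with one
lift serving all patterns at once ([trace_lift]).  What is left is a linear
system with coefficients in F(k) that is solvable in k, and a system over a
field that is solvable in an extension is solvable in the field itself ([field_descent]).

F-regularity for m = n = 2.  The only pattern is the full block, so Q embeds
into B.  If c x^q = sum_i a_i g_i^q with q larger than the degree of c, then
extracting at an exponent alpha of c makes c a nonzero constant, and the same
argument concludes ([frobenius_contraction]).

In all other cases Q has several components.  For x supported on one 2 x 2
block and y the sum of the entries off that block, x y = 0 and x + y is a
non-zero-divisor.  Then (x + y) x^q = x (x + y)^q puts x in the tight closure
of (x + y).  But x = r (x + y) would force r to be 1 on the block and 0 on any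
other component, whereas all components pass through the origin
([block_notin_ideal]). *)

(** * Field descent, Frobenius and the Cartier operator *)

(** Solvability of a linear system does not depend on the field: one Gaussian
elimination step, whose pivot is a nonzero value of the first unknown's column,
removes that unknown over both fields simultaneously.  There may be infinitely
many equations, indexed by T. *)
Lemma field_descent (K L : fieldType) (F : {rmorphism K -> L}) (T : Type)
    (N : nat) (v : 'I_N -> T -> K) (r : T -> K) (c : 'I_N -> L) :
    (forall t, F (r t) = \sum_j c j * F (v j t)) ->
  exists d : 'I_N -> K, forall t, r t = \sum_j d j * v j t.
Proof.
elim: N v r c => [|N IH] v r c rE.
  exists (fun=> 0) => t; apply/eqP.
  by rewrite big_ord0 -(fmorph_eq0 F) rE big_ord0.
pose u j := v (lift ord0 j).
have [[t0 a_neq0]|v0_eq0] := pselect (exists t0, v ord0 t0 != 0); last first.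
  have [|d dE] := IH u r (fun j => c (lift ord0 j)).
    move=> t; rewrite rE big_ord_recl.
    have [->|v0t] := eqVneq (v ord0 t) 0; last by case: v0_eq0; exists t.
    by rewrite rmorph0 mulr0 add0r.
  exists (fun j => oapp d 0 (unlift ord0 j)) => t.
  rewrite dE big_ord_recl unlift_none mul0r add0r.
  by apply: eq_bigr => j _; rewrite liftK.
set a := v ord0 t0 in a_neq0.
(* Subtracting this multiple of the pivot column makes w vanish at t0. *)
pose clear (w : T -> K) t := w t - w t0 / a * v ord0 t.
have [|d dE] := IH (fun j => clear (u j)) (clear r) (fun j => c (lift ord0 j)).
  move=> t; have := rE t0; rewrite big_ord_recl -/a => rt0.
  rewrite /clear rmorphB !rmorphM fmorphV rE rt0 big_ord_recl /=.
  rewrite mulrDl mulfK ?fmorph_eq0 // mulrDl opprD addrACA subrr add0r.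
  rewrite !mulr_suml -sumrB; apply: eq_bigr => j _.
  by rewrite rmorphB !rmorphM fmorphV mulrBr !mulrA.
exists (fun j => oapp d (r t0 / a - \sum_i d i * (u i t0 / a))
                      (unlift ord0 j)) => t.
rewrite big_ord_recl unlift_none /= mulrBl.
have /eqP := dE t; rewrite /clear subr_eq => /eqP->.
rewrite addrC -addrA; congr (_ + _); rewrite mulr_suml -sumrN -big_split /=.
by apply: eq_bigr => j _; rewrite liftK /= addrC mulrBr !mulrA.
Qed.

Lemma field_descent_fin (K L : fieldType) (F : {rmorphism K -> L}) (T : Type)
    (J : finType) (v : J -> T -> K) (r : T -> K) (c : J -> L) :
    (forall t, F (r t) = \sum_j c j * F (v j t)) ->
  exists d : J -> K, forall t, r t = \sum_j d j * v j t.
Proof.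
move=> rE.
have [|d dE] := @field_descent K L F T #|J| (fun i => v (enum_val i)) r
                  (fun i => c (enum_val i)).
  by move=> t; rewrite rE (reindex _ (onW_bij _ (enum_val_bij J))).
exists (fun j => d (enum_rank j)) => t.
rewrite dE [RHS](reindex _ (onW_bij _ (enum_val_bij J))).
by apply: eq_bigr => i _; rewrite enum_valK.
Qed.

Section Frobenius.
Variables (R : comNzRingType) (p : nat) (charR : p \in [pchar R]) (e : nat).

(** The proof that the characteristic is p is an argument so that it can be found
by unification when this map is used as a ring morphism. *)
Definition frob (_ : p \in [pchar R]) (x : R) := x ^+ (p ^ e).

Lemma frob_is_zmod_morphism : zmod_morphism (frob charR).
Proof.
move=> x y; rewrite /frob exprDn_pchar ?exprNn_pchar //.
all: by rewrite pnatX (pnatE _ (pcharf_prime charR)) charR.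
Qed.

Lemma frob_is_monoid_morphism : monoid_morphism (frob charR).
Proof. by split=> [|x y]; rewrite /frob ?expr1n ?exprMn. Qed.

HB.instance Definition _ :=
  GRing.isZmodMorphism.Build R R (frob charR) frob_is_zmod_morphism.
HB.instance Definition _ :=
  GRing.isMonoidMorphism.Build R R (frob charR) frob_is_monoid_morphism.
End Frobenius.

Section Cartier.
Variables (N : nat) (K : fieldType) (q : nat) (alpha : 'X_{1..N}).
Hypothesis alpha_lt : forall i, (alpha i < q)%N.
Hypothesis q_gt0 : (0 < q)%N.

(** The polynomial f is the sum, over the residues alpha modulo q, of the
products X^alpha * f_alpha(X^q); this is f_alpha. *)
Definition cartier (f : {mpoly K[N]}) : {mpoly K[N]} :=
  \sum_(d : 'X_{1..N < msize f}) f@_(d *+ q + alpha) *: 'X_[d].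

Lemma mcoeff_cartier f d : (cartier f)@_d = f@_(d *+ q + alpha).
Proof.
have [lt_d|le_d] := ltnP (mdeg d) (msize f).
  by rewrite (mcoeff_mpoly (fun d => f@_(d *+ q + alpha)%MM) lt_d).
have le_qd : (mdeg d <= mdeg (d *+ q + alpha)%MM)%N.
  by rewrite mdegD mdegMn (leq_trans _ (leq_addr _ _)) // leq_pmulr.
rewrite (memN_msupp_eq0 (msize_mdeg_ge (leq_trans le_d le_qd))).
rewrite raddf_sum big1 // => i _; rewrite /= mcoeffZ mcoeffX.
case: eqP => [iE|_]; last by rewrite mulr0.
by have := bmdeg i; rewrite iE ltnNge le_d.
Qed.

Lemma cartier_sum (I : Type) (s : seq I) (f : I -> {mpoly K[N]}) :
  cartier (\sum_(i <- s) f i) = \sum_(i <- s) cartier (f i).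
Proof.
apply/mpolyP => d; rewrite mcoeff_cartier !raddf_sum; apply: eq_bigr => i _ /=.
by rewrite mcoeff_cartier.
Qed.

Lemma cartierZ c f : cartier (c *: f) = c *: cartier f.
Proof. by apply/mpolyP => d; rewrite !(mcoeffZ, mcoeff_cartier). Qed.

Lemma mulm_inj (d d' : 'X_{1..N}) : (d *+ q = d' *+ q)%MM -> d = d'.
Proof.
move=> /mnmP dq; apply/mnmP => i; have := dq i.
by rewrite !mulmnE => /eqP; rewrite eqn_pmul2r // => /eqP.
Qed.

Lemma cartierX d : cartier 'X_[d *+ q + alpha] = 'X_[d].
Proof.
apply/mpolyP => d'; rewrite mcoeff_cartier !mcoeffX; congr (_%:R).
by rewrite eqm_add2r; congr nat_of_bool; apply/eqP/eqP => [/mulm_inj|->].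
Qed.

Lemma cartierX_eq0 b :
  (forall d, b <> (d *+ q + alpha)%MM) -> cartier 'X_[b] = 0.
Proof.
move=> bN; apply/mpolyP => d; rewrite mcoeff_cartier mcoeffX mcoeff0.
by case: eqP => // /bN.
Qed.

(** As the entries of alpha are below q, alpha is the residue modulo q of every
exponent that the operator retains. *)
Lemma cartierXM b m : cartier ('X_[b] * 'X_[m *+ q]) = cartier 'X_[b] * 'X_[m].
Proof.
have [[d ->]|bN] := pselect (exists d, b = d *+ q + alpha)%MM.
  rewrite cartierX -!mpolyXD -addmA (addmC alpha) addmA.
  suff -> : (d *+ q + m *+ q = (d + m) *+ q)%MM by rewrite cartierX.
  by apply/mnmP => i; rewrite !(mulmnE, mnmDE) mulnDl.
rewrite [in RHS]cartierX_eq0 => [|d bE]; last by apply: bN; exists d.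
rewrite mul0r -mpolyXD cartierX_eq0 // => d /mnmP bE; apply: bN.
exists [multinom (b i %/ q)%N | i < N]; apply/mnmP => i.
rewrite mnmDE mulmnE mnmE [LHS](divn_eq _ q); congr (_ + _)%N.
have /(congr1 (modn^~ q)) := bE i; rewrite !mnmDE !mulmnE.
by rewrite modnMDl addnC modnMDl (modn_small (alpha_lt i)).
Qed.
End Cartier.

Section CartierFrobenius.
Variables (N p : nat) (K : fieldType) (charK : p \in [pchar K]) (e : nat).
Variable alpha : 'X_{1..N}.
Hypothesis alpha_lt : forall i, (alpha i < p ^ e)%N.

Let q_gt0 : (0 < p ^ e)%N.
Proof. by rewrite expn_gt0 prime_gt0 ?(pcharf_prime charK). Qed.

Lemma mpoly_pchar : p \in [pchar {mpoly K[N]}].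
Proof. exact: (rmorph_pchar (@mpolyC N K)). Qed.

(** Linearity of the operator over q-th powers.  The operator acts on
exponents only, so what remains of g^q is g with its coefficients raised to
the power q. *)
Lemma cartierM (b g : {mpoly K[N]}) :
  cartier (p ^ e) alpha (b * g ^+ (p ^ e)) =
  cartier (p ^ e) alpha b * map_mpoly (frob e charK) g.
Proof.
rewrite -/(frob e mpoly_pchar g) [g]mpolyE !raddf_sum !mulr_sumr /=.
rewrite cartier_sum //; apply: eq_bigr => m _ /=.
rewrite map_mpolyZ map_mpolyX /frob exprZn mpolyXn -!scalerAr cartierZ //.
rewrite -[RHS]/(g@_m ^+ (p ^ e) *: _); congr (_ *: _).
rewrite [b in LHS]mpolyE [b in RHS]mpolyE mulr_suml !cartier_sum // mulr_suml.
apply: eq_bigr => d _; rewrite -scalerAl !cartierZ // -scalerAl.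
by rewrite cartierXM.
Qed.

Lemma cartier_const (c : {mpoly K[N]}) : (msize c <= p ^ e)%N ->
  cartier (p ^ e) alpha c = (c@_alpha)%:MP.
Proof.
move=> size_c; apply/mpolyP => d; rewrite mcoeff_cartier // mcoeffC.
case: eqP => [->|/eqP d_neq0]; last first.
  rewrite mulr0 memN_msupp_eq0 // msize_mdeg_ge //.
  rewrite (leq_trans size_c) // mdegD mdegMn (leq_trans _ (leq_addr _ _)) //.
  by rewrite leq_pmull // lt0n mdeg_eq0.
rewrite mulr1; congr (c@_ _); apply/mnmP => i.
by rewrite mnmDE mulmnE mnm0E mul0n.
Qed.
End CartierFrobenius.

(** * Matrices with vanishing 2 x 2 permanents over a reduced ring *)

Section PermanentalMatrix.
Variables (Q : comNzRingType) (I J : eqType) (z : I -> J -> Q) (w : Q).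
Hypothesis swap : forall i i' j j', i != i' -> j != j' ->
  z i j * z i' j' = - (z i j' * z i' j).
Hypothesis two_reg : forall x : Q, x *+ 2 = 0 -> x = 0.
Hypothesis reduced : forall (x : Q) d, x ^+ d = 0 -> x = 0.

(** In other words, w lies in the radical of the ideal generated by the entry.
Unlike plain divisibility, this relation is closed under completing
rectangles. *)
Definition divides_power i j := exists d u, w ^+ d = u * z i j.

Lemma divides_power_box i i' j j' :
  divides_power i j -> divides_power i' j' -> divides_power i j'.
Proof.
move=> dvd_ij dvd_ij'.
have [->//|ni] := eqVneq i i'; have [<-//|nj] := eqVneq j j'.
have [[d [u wd]] [d' [u' wd']]] := (dvd_ij, dvd_ij').
exists (d + d')%N, (- (u * u' * z i' j)).
by rewrite exprD wd wd' mulrACA (swap ni nj) mulrN !mulNr mulrA mulrAC.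
Qed.

(** Three swaps return to the same product with the sign (-1)^3. *)
Lemma three_columns_eq0 i i' a b c : i != i' ->
  a != b -> b != c -> c != a -> z i a * z i b * z i' c = 0.
Proof.
move=> ni nab nbc nca; apply: two_reg; rewrite mulr2n -[X in X + _]mulrA.
rewrite (swap ni nbc) mulrN mulrCA (swap ni nab) mulrN opprK.
by rewrite mulrCA (swap ni nca) mulrN mulrCA mulrA addNr.
Qed.

(** Completing rectangles puts the three columns a, b, c in each of the rows i
and i', so some power of w is a multiple of a product as in
[three_columns_eq0]. *)
Lemma wide_support_eq0 i i' j j' ra rb rc a b c :
    divides_power i j -> divides_power i' j' -> i != i' ->
    divides_power ra a -> divides_power rb b -> divides_power rc c ->
    a != b -> b != c -> c != a ->
  w = 0.
Proof.
move=> wi wi' ni wa wb wc nab nbc nca.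
have [d1 [u1 E1]] := divides_power_box wi wa.
have [d2 [u2 E2]] := divides_power_box wi wb.
have [d3 [u3 E3]] := divides_power_box wi' wc.
apply: (@reduced w (d1 + d2 + d3)); rewrite !exprD E1 E2 E3.
by rewrite (mulrACA u1) (mulrACA (u1 * u2)) three_columns_eq0 ?mulr0.
Qed.
End PermanentalMatrix.

(** * Row and column sums of an exponent matrix *)

Section Margins.
Variables (m n : nat).

Definition cell (l : 'I_(m * n)) : 'I_m * 'I_n :=
  enum_val (cast_ord (esym (mxvec_cast m n)) l).

Lemma cell_index i j : cell (mxvec_index i j) = (i, j).
Proof. by rewrite /cell /mxvec_index cast_ordK enum_rankK. Qed.

Lemma index_cell l : mxvec_index (cell l).1 (cell l).2 = l.
Proof. by case/mxvec_indexP: l => i j; rewrite cell_index. Qed.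

Definition cell_margins (l : 'I_(m * n)) : 'X_{1..m + n} :=
  (U_(lshift n (cell l).1) + U_(rshift m (cell l).2))%MM.

(** The first m entries are the row sums and the last n the column sums of the
m x n exponent matrix u. *)
Definition margins (u : 'X_{1..m * n}) : 'X_{1..m + n} :=
  (\sum_l cell_margins l *+ u l)%MM.

Lemma marginsD u v : margins (u + v) = (margins u + margins v)%MM.
Proof.
apply/mnmP => i; rewrite mnmDE !mnm_sumE -big_split; apply: eq_bigr => l _ /=.
by rewrite !mulmnE mnmDE mulnDr.
Qed.

Lemma marginsU l : margins U_(l) = cell_margins l.
Proof.
apply/mnmP => i; rewrite mnm_sumE (bigD1 l) //= big1 => [|l' /negPf nl].
  by rewrite mulmnE mnm1E eqxx muln1 addn0.
by rewrite mulmnE mnm1E eq_sym nl muln0.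
Qed.

Lemma margins_row u i :
  margins u (lshift n i) = (\sum_(l | (cell l).1 == i) u l)%N.
Proof.
rewrite mnm_sumE [RHS]big_mkcond; apply: eq_bigr => l _.
rewrite mulmnE mnmDE !mnm1E eq_lshift eq_rlshift addn0.
by case: eqP; rewrite ?mul1n ?mul0n.
Qed.

Lemma margins_col u j :
  margins u (rshift m j) = (\sum_(l | (cell l).2 == j) u l)%N.
Proof.
rewrite mnm_sumE [RHS]big_mkcond; apply: eq_bigr => l _.
rewrite mulmnE mnmDE !mnm1E eq_rshift eq_lrshift add0n.
by case: eqP; rewrite ?mul1n ?mul0n.
Qed.

Lemma margins_row_gt0 (u : 'X_{1..m * n}) i :
  reflect (exists2 l, (cell l).1 = i & (0 < u l)%N)
    (0 < margins u (lshift n i))%N.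
Proof.
rewrite margins_row lt0n sum_nat_eq0 negb_forall.
apply: (iffP existsP) => [[l]|[l <- ul]].
  by rewrite negb_imply -lt0n => /andP[/eqP <- ul]; exists l.
by exists l; rewrite eqxx -lt0n.
Qed.

Lemma margins_col_gt0 (u : 'X_{1..m * n}) j :
  reflect (exists2 l, (cell l).2 = j & (0 < u l)%N)
    (0 < margins u (rshift m j))%N.
Proof.
rewrite margins_col lt0n sum_nat_eq0 negb_forall.
apply: (iffP existsP) => [[l]|[l <- ul]].
  by rewrite negb_imply -lt0n => /andP[/eqP <- ul]; exists l.
by exists l; rewrite eqxx -lt0n.
Qed.

Definition balanced (d : 'X_{1..m + n}) :=
  (\sum_i d (lshift n i) == \sum_j d (rshift m j))%N.

Lemma balanced_margins u : balanced (margins u).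
Proof.
apply/eqP; transitivity (\sum_l u l)%N.
  rewrite [RHS](partition_big (fun l => (cell l).1) predT) //=.
  by apply: eq_bigr => i _; exact: margins_row.
rewrite (partition_big (fun l => (cell l).2) predT) //=.
by apply: eq_bigr => j _; exact/esym/margins_col.
Qed.

Lemma margins_eq0 u : (margins u == 0%MM) = (u == 0%MM).
Proof.
apply/eqP/eqP => [u0|->]; last first.
  by apply/mnmP => i; rewrite mnm_sumE mnm0E big1 // => l _;
    rewrite mulmnE mnm0E muln0.
apply/mnmP => l; rewrite mnm0E; apply/eqP; rewrite -leqn0 leqNgt.
apply/negP => ul.
have : (0 < margins u (lshift n (cell l).1))%N by apply/margins_row_gt0; exists l.
by rewrite u0 mnm0E.
Qed.

Lemma mnm1_le (N : nat) (l : 'I_N) (u : 'X_{1..N}) :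
  (0 < u l)%N -> (U_(l) <= u)%MM.
Proof.
by move=> ul; apply/mnm_lepP => i; rewrite mnm1E; case: eqP => [<-|].
Qed.

(** A nonzero balanced d has a positive row sum and a positive column sum; put a
unit in the corresponding cell and continue with the rest. *)
Lemma balanced_is_margins d : balanced d -> exists u, d = margins u.
Proof.
have [N] := ubnP (mdeg d); elim: N d => // N IH d lt_d bal_d.
have [->|d_neq0] := eqVneq d 0%MM.
  by exists 0%MM; apply/esym/eqP; rewrite margins_eq0.
have [i di] : exists i, (0 < d (lshift n i))%N.
  apply/existsP; apply: contraNT d_neq0; rewrite negb_exists => /forallP d0.
  have row0 i : d (lshift n i) = 0%N by apply/eqP; rewrite -leqn0 leqNgt d0.
  move: bal_d; rewrite /balanced big1 // eq_sym sum_nat_eq0 => /forallP col0.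
  apply/eqP/mnmP => x; rewrite mnm0E -[x]splitK.
  by case: split => j /=; [rewrite row0|apply/eqP/col0].
have [j dj] : exists j, (0 < d (rshift m j))%N.
  apply/existsP; apply: contraTT bal_d; rewrite negb_exists => /forallP d0.
  rewrite /balanced [X in _ == X]big1 => [|j _].
    by rewrite -lt0n (bigD1 i) //= ltn_addr.
  by apply/eqP; rewrite -leqn0 leqNgt d0.
pose l := mxvec_index i j; have posl : cell l = (i, j) by rewrite cell_index.
have le_l : (cell_margins l <= d)%MM.
  apply/mnm_lepP => x; rewrite mnmDE !mnm1E posl /=.
  case: eqP => [<-|_]; case: eqP => [/eqP|//];
    by rewrite ?eq_rlshift // => /eqP <-.
have dE := submK le_l; set d' := (d - _)%MM in dE.
have [||u d'E] := IH d'.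
- by move: lt_d; rewrite -dE mdegD mdegD !mdeg1 addn2 !ltnS; apply: ltnW.
- move: bal_d; rewrite /balanced -dE.
  under eq_bigr do rewrite mnmDE.
  under [X in _ == X]eq_bigr do rewrite mnmDE.
  by rewrite !big_split /= -marginsU (eqP (balanced_margins _)) eqn_add2r.
by exists (u + U_(l))%MM; rewrite marginsD marginsU -d'E.
Qed.

End Margins.

(** * Sign patterns and the homomorphisms that they define *)

Section Patterns.
Variables (m n : nat).
Implicit Types e : {set 'I_m} * {set 'I_n}.

(** The pairs of a row set and a column set whose products support the patterns.
The lower bounds 3 make a block incomparable with every other pair, see
[component_antichain]; they also leave the full block alone when m = n = 2. *)
Definition component e :=
  [|| (#|e.1| == 2) && (#|e.2| == 2), (#|e.1| == 1) && (2 < #|e.2|)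
    | (2 < #|e.1|) && (#|e.2| == 1)]%N.

(** Among the cells of e, this holds at the bottom right corner of a 2 x 2 block
only, and at no cell of a single row or column. *)
Definition flipped e i j :=
  [exists i' in e.1, i' < i]%N && [exists j' in e.2, j' < j]%N.

Definition sign_pattern (K : nzRingType) e i j : K :=
  if (i \in e.1) && (j \in e.2) then (-1) ^+ flipped e i j else 0.

Lemma set2_of (T : finType) (A : {set T}) x y :
  #|A| = 2%N -> x \in A -> y \in A -> x != y -> A = [set x; y].
Proof.
move=> cardA xA yA nxy; apply/esym/eqP.
rewrite eqEcard cards2 nxy cardA /= andbT.
by apply/subsetP => t; rewrite !inE => /orP[] /eqP->.
Qed.

Lemma below_pair N (A : {set 'I_N}) (x y : 'I_N) :
    #|A| = 2%N -> x \in A -> y \in A -> (x < y)%N ->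
  [exists t in A, t < x]%N = false /\ [exists t in A, t < y]%N = true.
Proof.
move=> cardA xA yA lt_xy; split; last by apply/exists_inP; exists x.
rewrite (set2_of cardA xA yA); last by rewrite neq_ltn lt_xy.
apply/exists_inP => -[t]; rewrite !inE => /orP[] /eqP->; first by rewrite ltnn.
by rewrite ltnNge ltnW.
Qed.

Lemma component_pair e i i' j j' : component e ->
    i \in e.1 -> i' \in e.1 -> i != i' -> j \in e.2 -> j' \in e.2 -> j != j' ->
  #|e.1| = 2%N /\ #|e.2| = 2%N.
Proof.
move=> ce iA iA' ni jB jB' nj.
have gt1A : (1 < #|e.1|)%N by apply/card_gt1P; exists i, i'.
have gt1B : (1 < #|e.2|)%N by apply/card_gt1P; exists j, j'.
case/or3P: ce => /andP[cA cB]; first by split; apply/eqP.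
  by rewrite (eqP cA) in gt1A.
by rewrite (eqP cB) in gt1B.
Qed.

Lemma sign_pattern_permanent (K : nzRingType) e (i i' : 'I_m) (j j' : 'I_n) :
    component e -> (i < i')%N -> (j < j')%N ->
  sign_pattern K e i j * sign_pattern K e i' j' +
  sign_pattern K e i j' * sign_pattern K e i' j = 0.
Proof.
move=> ce lt_i lt_j; rewrite /sign_pattern.
have [iA|] := boolP (i \in e.1); last by rewrite !mul0r addr0.
have [iA'|] := boolP (i' \in e.1); last by rewrite !mulr0 addr0.
have [jB|] := boolP (j \in e.2); last by rewrite mul0r mulr0 addr0.
have [jB'|] := boolP (j' \in e.2); last by rewrite mul0r mulr0 addr0.
have [||cA cB] := component_pair ce iA iA' _ jB jB';
  try by rewrite neq_ltn ?lt_i ?lt_j.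
have [xi yi] := below_pair cA iA iA' lt_i.
have [xj yj] := below_pair cB jB jB' lt_j.
by rewrite /flipped xi yi xj yj /= !expr0 !mul1r addNr.
Qed.

Lemma sign_pattern_neq0 (K : nzRingType) e i j :
  (sign_pattern K e i j != 0) = (i \in e.1) && (j \in e.2).
Proof. by rewrite /sign_pattern; case: ifP; rewrite ?signr_eq0 ?eqxx. Qed.

Lemma sign_pattern_rmorph (K L : nzRingType) (f : {rmorphism K -> L}) e i j :
  f (sign_pattern K e i j) = sign_pattern L e i j.
Proof. by rewrite /sign_pattern; case: ifP; rewrite ?rmorph_sign ?rmorph0. Qed.

(** If one of the two is a block, then the inclusions bound the sizes of the other
one, which can only be a block as well. *)
Lemma component_antichain e e' : component e -> component e' ->
    e.1 \subset e'.1 -> e.2 \subset e'.2 ->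
  #|e.1| = 2%N \/ #|e'.1| = 2%N -> e = e'.
Proof.
case: e e' => A B [A' B'] /= ce ce' sA sB c2.
have leA := subset_leq_card sA; have leB := subset_leq_card sB.
suff [eA eB] : (#|A'| <= #|A|)%N /\ (#|B'| <= #|B|)%N.
  by congr (_, _); apply/eqP; rewrite eqEcard ?sA ?sB ?eA ?eB.
move: c2 ce ce' leA leB; rewrite /component /=.
by move=> *; lia.
Qed.

Section Hom.
Variables (K : fieldType) (e : {set 'I_m} * {set 'I_n}).

(** The value at the pattern of the monomial with exponent matrix u. *)
Definition weight (u : 'X_{1..m * n}) : K :=
  \prod_l sign_pattern K e (cell l).1 (cell l).2 ^+ u l.

(** The sign-twisted Segre parametrization of the component e by the products
s_i t_j, where s_i and t_j are the first m and the last n variables. *)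
Definition pattern_mor : {mpoly K[m * n]} -> {mpoly K[m + n]} :=
  mmap (@mpolyC (m + n) K)
       (fun l => sign_pattern K e (cell l).1 (cell l).2 *: 'X_[cell_margins l]).
HB.instance Definition _ := GRing.RMorphism.on pattern_mor.

Lemma pattern_morB : {morph pattern_mor : f g / f - g}.
Proof. exact: rmorphB. Qed.
Lemma pattern_morD : {morph pattern_mor : f g / f + g}.
Proof. exact: rmorphD. Qed.
Lemma pattern_morM : {morph pattern_mor : f g / f * g}.
Proof. exact: rmorphM. Qed.
Lemma pattern_mor_exp d : {morph pattern_mor : f / f ^+ d}.
Proof. exact: rmorphXn. Qed.
Lemma pattern_mor_sum (I : Type) (s : seq I) (P : pred I)
    (f : I -> {mpoly K[m * n]}) :
  pattern_mor (\sum_(i <- s | P i) f i) = \sum_(i <- s | P i) pattern_mor (f i).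
Proof. exact: rmorph_sum. Qed.

Lemma pattern_morX u : pattern_mor 'X_[u] = weight u *: 'X_[margins u].
Proof.
rewrite /pattern_mor mmapX /mmap1; under eq_bigr do rewrite exprZn.
by rewrite scaler_prod mprodXnE.
Qed.

Lemma pattern_morZ c f : pattern_mor (c *: f) = c *: pattern_mor f.
Proof. by rewrite /pattern_mor mmapZ mul_mpolyC. Qed.

Lemma pattern_morU l : pattern_mor 'X_l =
  sign_pattern K e (cell l).1 (cell l).2 *: 'X_[cell_margins l].
Proof. by rewrite /pattern_mor mmapX mmap1U. Qed.

Lemma mcoeff_pattern_mor f d : (pattern_mor f)@_d =
  \sum_(u <- msupp f) f@_u * weight u * (margins u == d)%:R.
Proof.
rewrite {1}[f]mpolyE pattern_mor_sum raddf_sum.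
apply: eq_bigr => u _ /=.
rewrite pattern_morZ pattern_morX !mcoeffZ mcoeffX mulrA //.
Qed.

Lemma weight_neq0 (u : 'X_{1..m * n}) :
  (forall l, (0 < u l)%N -> (cell l).1 \in e.1 /\ (cell l).2 \in e.2) ->
  weight u != 0.
Proof.
move=> ue; apply/prodf_neq0 => l _.
have [->|ul] := posnP (u l); first by rewrite expr0 oner_eq0.
by rewrite expf_neq0 // sign_pattern_neq0; apply/andP/ue.
Qed.

(** Every component contains the origin. *)
Lemma pattern_mor0 f : (pattern_mor f).@[fun=> 0] = f.@[fun=> 0].
Proof.
rewrite [f]mpolyE pattern_mor_sum !raddf_sum; apply: eq_bigr => u _ /=.
rewrite pattern_morZ !mevalZ pattern_morX mevalZ; congr (_ * _).
have [->|u_neq0] := eqVneq u 0%MM.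
  have /eqP-> : margins (0%MM : 'X_{1..m * n}) == 0%MM by rewrite margins_eq0.
  by rewrite !mpolyX0 !meval1 mulr1 /weight big1 // => l _; rewrite mnm0E.
rewrite !mevalX.
have prod0 N (v : 'X_{1..N}) : v != 0%MM -> \prod_i (0 : K) ^+ v i = 0.
  move=> v_neq0; apply/eqP; rewrite prodf_seq_eq0; apply/hasP.
  have [i vi] : exists i, v i != 0%N.
    apply/existsP; apply: contraNT v_neq0; rewrite negb_exists => /forallP v0.
    by apply/eqP/mnmP => i; rewrite mnm0E; apply/eqP; rewrite -[_ == _]negbK v0.
  by exists i; rewrite ?mem_index_enum //= expr0n (negPf vi).
by rewrite !prod0 ?mulr0 ?margins_eq0.
Qed.

End Hom.
End Patterns.

(** * Monomials modulo the radical *)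

Section Quotient.
Variables (K : fieldType) (m n : nat).
Local Notation S := {mpoly K[m * n]}.
Local Notation Q := (P2_quotient K m n).

Definition proj (f : S) : Q := (\pi_({ideal_quot (@rad_P2 K m n)}) f)%qT.

Lemma proj_is_zmod_morphism : zmod_morphism proj.
Proof. by move=> x y; rewrite /proj rmorphB. Qed.
Lemma proj_is_monoid_morphism : monoid_morphism proj.
Proof. by split=> [|x y]; rewrite /proj ?rmorph1 ?rmorphM. Qed.
HB.instance Definition _ :=
  GRing.isZmodMorphism.Build S Q proj proj_is_zmod_morphism.
HB.instance Definition _ :=
  GRing.isMonoidMorphism.Build S Q proj proj_is_monoid_morphism.

Lemma projM : {morph proj : f g / f * g}.
Proof. exact: rmorphM. Qed.
Lemma projB : {morph proj : f g / f - g}.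
Proof. exact: rmorphB. Qed.

Lemma proj_surj x : exists f, x = proj f.
Proof. by exists (repr x); rewrite /proj reprK. Qed.

Lemma proj_eq0 f : proj f = 0 <-> radical (@P2 K m n) f.
Proof.
rewrite -[0](rmorph0 proj) /proj; split=> [/eqP|If].
  by rewrite -Quotient.idealrBE subr0 => /asboolP.
by apply/eqP; rewrite -Quotient.idealrBE subr0; apply/asboolP.
Qed.

Lemma quotient_reduced (x : Q) d : x ^+ d = 0 -> x = 0.
Proof.
case: d => [/eqP|d]; first by rewrite expr0 oner_eq0.
have [f ->] := proj_surj x; rewrite -rmorphXn => /proj_eq0[c c_gt0 fdc].
by apply/proj_eq0; exists (d.+1 * c)%N; rewrite ?muln_gt0 // exprM.
Qed.

Lemma ideal_gen_mem (R : comNzRingType) (s : seq R) x :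
  x \in s -> ideal_gen s x.
Proof.
move=> xs; have lt_i : (index x s < size s)%N by rewrite index_mem.
exists (fun i => (i == Ordinal lt_i)%:R).
rewrite (bigD1 (Ordinal lt_i)) //= eqxx mul1r nth_index // big1 ?addr0 //.
by move=> i /negPf->; rewrite mul0r.
Qed.

Definition entry i j := proj 'X_(mxvec_index i j).

Lemma entry_cell l : entry (cell l).1 (cell l).2 = proj 'X_l.
Proof. by rewrite /entry index_cell. Qed.

(** The generators only provide the case i < i', j < j'; the relation is invariant
under exchanging the rows or the columns. *)
Lemma entry_swap i i' j j' : i != i' -> j != j' ->
  entry i j * entry i' j' = - (entry i j' * entry i' j).
Proof.
have swap_lt (a a' : 'I_m) (b b' : 'I_n) : (a < a')%N -> (b < b')%N ->
    entry a b * entry a' b' + entry a b' * entry a' b = 0.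
  move=> lt_a lt_b; rewrite -!rmorphM -rmorphD; apply/proj_eq0.
  exists 1%N => //; rewrite expr1; apply: ideal_gen_mem.
  apply/allpairsP; exists ((a, a'), (b, b')); rewrite !mem_enum; split=> //.
  by rewrite /permanent2 !mxE.
rewrite !neq_ltn => /orP[] lt_i /orP[] lt_j; apply/eqP;
  rewrite -addr_eq0; apply/eqP.
- exact: swap_lt.
- by rewrite addrC swap_lt.
- by rewrite addrC mulrC [X in _ + X]mulrC swap_lt.
- by rewrite mulrC [X in _ + X]mulrC swap_lt.
Qed.

(** Permanents of the pattern vanish, and the target is a domain. *)
Lemma pattern_mor_rad e f : component e ->
  radical (@P2 K m n) f -> pattern_mor e f = 0.
Proof.
move=> ce [d _ [a fE]]; apply/eqP; suff : pattern_mor e f ^+ d == 0.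
  by rewrite expf_eq0 => /andP[].
rewrite -pattern_mor_exp fE pattern_mor_sum big1 // => i _.
have /allpairsP[[u v] [uP vP ->]] : (P2_gens K m n)`_i \in P2_gens K m n.
  by rewrite mem_nth.
move: uP vP; rewrite !mem_enum !inE /= => lt_u lt_v.
rewrite /permanent2 !mxE !(tnth_nth u.1) !(tnth_nth v.1) /=.
rewrite pattern_morM pattern_morD !pattern_morM !pattern_morU !cell_index /=.
rewrite -!scalerAl -!scalerAr !scalerA -!mpolyXD.
have -> : (cell_margins (mxvec_index u.1 v.1) +
    cell_margins (mxvec_index u.2 v.2) =
    cell_margins (mxvec_index u.1 v.2) +
    cell_margins (mxvec_index u.2 v.1))%MM.
  by apply/mnmP => x; rewrite /cell_margins !cell_index /= !mnmDE; lia.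
by rewrite -scalerDl sign_pattern_permanent // scale0r mulr0.
Qed.

Lemma projX_divisible (u : 'X_{1..m * n}) l : (0 < u l)%N ->
  proj 'X_[u] = proj 'X_[u - U_(l)] * proj 'X_l.
Proof. by move=> ul; rewrite -projM -mpolyXD submK // mnm1_le. Qed.

(** Induction on the degree.  Let v contain the cell l.  If u contains l too,
cancel it.  Otherwise u contains a cell l1 in the row of l and a cell l2 in its
column; swapping these two brings l into u at the cost of one sign. *)
Lemma same_margins u v : margins u = margins v ->
  exists b : bool, proj 'X_[u] = (-1) ^+ b * proj 'X_[v].
Proof.
have [N] := ubnP (mdeg v); elim: N u v => // N IH u v lt_v uv.
have [v0|v_neq0] := eqVneq v 0%MM.
  have /eqP-> : u == 0%MM by rewrite -margins_eq0 uv v0 margins_eq0.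
  by exists false; rewrite v0 mul1r.
have [l vl] : exists l, (0 < v l)%N.
  apply/existsP; apply: contraNT v_neq0; rewrite negb_exists => /forallP v0.
  by apply/eqP/mnmP => l; rewrite mnm0E; apply/eqP; rewrite -leqn0 leqNgt v0.
have vE := submK (mnm1_le vl); set v' := (v - _)%MM in vE.
have lt_v' : (mdeg v' < N)%N by move: lt_v; rewrite -vE mdegD mdeg1 addn1.
have vE' : 'X_[v] = 'X_[v'] * 'X_l :> S by rewrite -mpolyXD vE.
have [ul|] := posnP (u l); last first.
  move=> ul; have uE := submK (mnm1_le ul); set u' := (u - _)%MM in uE.
  have [||b bE] := IH u' v' => //.
    by move/eqP: uv; rewrite -uE -vE !marginsD eqm_add2r => /eqP.
  by exists b; rewrite vE' -uE mpolyXD !projM bE mulrA.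
have /margins_row_gt0[l1 l1E ul1] : (0 < margins u (lshift n (cell l).1))%N.
  by rewrite uv; apply/margins_row_gt0; exists l.
have /margins_col_gt0[l2 l2E ul2] : (0 < margins u (rshift m (cell l).2))%N.
  by rewrite uv; apply/margins_col_gt0; exists l.
have n1 : (cell l).2 != (cell l1).2.
  rewrite eq_sym; apply: contraTneq ul1 => E.
  by rewrite -[l1]index_cell l1E E index_cell ul.
have n2 : (cell l2).1 != (cell l).1.
  apply: contraTneq ul2 => E.
  by rewrite -[l2]index_cell l2E E index_cell ul.
have l12 : l1 != l2 by apply: contraNneq n2 => <-; rewrite l1E.
have uE1 := submK (mnm1_le ul1); set u1 := (u - _)%MM in uE1.
have u1l2 : (0 < u1 l2)%N by rewrite mnmBE mnm1E (negPf l12) subn0.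
have uE2 := submK (mnm1_le u1l2); set u2 := (u1 - _)%MM in uE2.
pose l3 := mxvec_index (cell l2).1 (cell l1).2.
have [||b bE] := IH (u2 + U_(l3))%MM v' => //.
  move/eqP: uv; rewrite -uE1 -uE2 -vE !marginsD !marginsU
    /cell_margins cell_index /=.
  rewrite l1E l2E => /eqP/mnmP E; apply/mnmP => x; have := E x.
  by rewrite !mnmDE; lia.
exists (~~ b); rewrite vE' -uE1 -uE2 !mpolyXD !projM.
rewrite mpolyXD projM in bE.
rewrite -!entry_cell l1E l2E -mulrA (entry_swap n2 n1).
rewrite mulrN mulrA [entry (cell l2).1 _]/entry bE.
by case: b {bE}; rewrite /= ?mulN1r ?mul1r ?mulNr ?opprK.
Qed.

(** The sign relating two monomials in the quotient is also the ratio of their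
weights, whatever the pattern. *)
Lemma same_margins_weight u v : margins u = margins v ->
  exists b : bool, proj 'X_[u] = (-1) ^+ b * proj 'X_[v] /\
    forall e, component e -> weight K e u = (-1) ^+ b * weight K e v.
Proof.
move=> uv; have [b bE] := same_margins uv; exists b; split=> // e ce.
have /proj_eq0/(pattern_mor_rad ce) : proj ('X_[u] - (-1) ^+ b *: 'X_[v]) = 0.
  by rewrite projB -mul_mpolyC projM !rmorph_sign bE subrr.
rewrite pattern_morB pattern_morZ !pattern_morX uv scalerA -scalerBl.
move=> /(congr1 (mcoeff (margins v))).
rewrite mcoeffZ mcoeffX eqxx mulr1 mcoeff0.
by move/eqP; rewrite subr_eq0 => /eqP.
Qed.
End Quotient.

(** * The radical as an intersection of kernels *)

Lemma superset_of_card (T : finType) (A : {set T}) c :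
  (#|A| <= c <= #|T|)%N -> exists2 B : {set T}, A \subset B & #|B| = c.
Proof.
move=> /andP[le_Ac]; rewrite -(subnKC le_Ac).
elim: (c - #|A|)%N => [|d IH] le_cT.
  by exists A; rewrite ?addn0.
have [|B sAB cardB] := IH; first by rewrite (leq_trans _ le_cT) // addnS.
have /set0Pn[x xB] : ~: B != set0.
  by rewrite -card_gt0 cardsCs setCK subn_gt0 cardB -addnS.
exists (x |: B); first by rewrite subsetU // sAB orbT.
by rewrite cardsU1 cardB addnS; rewrite inE in xB; rewrite xB.
Qed.

(** The row and column sets of a support that [wide_support_eq0] and its
transpose leave open fit inside a pattern. *)
Lemma component_cover m n (A : {set 'I_m}) (B : {set 'I_n}) :
    (1 < m)%N -> (1 < n)%N ->
    ~~ ((1 < #|A|) && (2 < #|B|))%N -> ~~ ((2 < #|A|) && (1 < #|B|))%N ->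
  exists e, [/\ component e, A \subset e.1 & B \subset e.2].
Proof.
move=> m_ge2 n_ge2 narrow low.
have [le_A|gt_A] := leqP #|A| 2; have [le_B|gt_B] := leqP #|B| 2.
- have [|A' sA cA] := @superset_of_card _ A 2; first by rewrite le_A card_ord.
  have [|B' sB cB] := @superset_of_card _ B 2; first by rewrite le_B card_ord.
  by exists (A', B'); rewrite /component /= cA cB.
- have [|A' sA cA] := @superset_of_card _ A 1; first by rewrite card_ord; lia.
  by exists (A', B); rewrite /component /= cA gt_B orbT.
- have [|B' sB cB] := @superset_of_card _ B 1; first by rewrite card_ord; lia.
  by exists (A, B'); rewrite /component /= cB gt_A !orbT.
- by move: narrow; rewrite gt_B andbT (ltnW gt_A).
Qed.

Section OddCharacteristic.
Variables (K : fieldType) (p m n : nat).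
Hypotheses (charK : p \in [pchar K]) (p_gt2 : (2 < p)%N).
Hypotheses (m_ge2 : (2 <= m)%N) (n_ge2 : (2 <= n)%N).
Local Notation S := {mpoly K[m * n]}.
Local Notation Q := (P2_quotient K m n).

Lemma quotient_two_reg (x : Q) : x *+ 2 = 0 -> x = 0.
Proof.
have two_neq0 : (2%:R : K) != 0.
  by rewrite -(dvdn_pcharf charK) gtnNdvd.
have [f ->] := proj_surj x => x0.
rewrite -[f]scale1r -(mulVf two_neq0) -scalerA -mul_mpolyC projM.
by rewrite scaler_nat [proj (f *+ 2)]rmorphMn x0 mulr0.
Qed.

Lemma monomial_dichotomy u : proj 'X_[u] = 0 :> Q \/
  exists2 e, component e & weight K e u != 0.
Proof.
pose A := [set i | 0 < margins u (lshift n i)]%N.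
pose B := [set j | 0 < margins u (rshift m j)]%N.
have inA i : i \in A ->
    exists j, divides_power (@entry K m n) (proj 'X_[u]) i j.
  rewrite inE => /margins_row_gt0[l <- ul]; exists (cell l).2, 1%N.
  exists (proj 'X_[u - U_(l)]); rewrite entry_cell expr1.
  exact: projX_divisible.
have inB j : j \in B ->
    exists i, divides_power (@entry K m n) (proj 'X_[u]) i j.
  rewrite inE => /margins_col_gt0[l <- ul]; exists (cell l).1, 1%N.
  exists (proj 'X_[u - U_(l)]); rewrite entry_cell expr1.
  exact: projX_divisible.
have [/andP[/card_gt1P[i [i' [/inA[j wj] /inA[j' wj'] ni]]] /card_gt2P]
      |narrow] := boolP ((1 < #|A|) && (2 < #|B|))%N.
  case=> [a [b [c [[/inB[ra wa] /inB[rb wb] /inB[rc wc]] [nab nbc nca]]]]]; left.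
  exact: (wide_support_eq0 (@entry_swap K m n) quotient_two_reg
            (@quotient_reduced K m n)
            wj wj' ni wa wb wc nab nbc nca).
have [/andP[/card_gt2P]|low] := boolP ((2 < #|A|) && (1 < #|B|))%N.
  case=> [a [b [c [[/inA[ra wa] /inA[rb wb] /inA[rc wc]] [nab nbc nca]]]]].
  case/card_gt1P=> [j [j' [/inB[i wi] /inB[i' wi'] nj]]]; left.
  (* Columns now play the role of rows. *)
  apply: (@wide_support_eq0 Q _ _ (fun j i => entry K i j) _ _
           quotient_two_reg (@quotient_reduced K m n)
            _ _ _ _ _ _ _ _ _ _ wi wi' nj wa wb wc nab nbc nca).
  by move=> x x' y y' nx ny; rewrite entry_swap // mulrC.
have [e [ce sA sB]] := component_cover m_ge2 n_ge2 narrow low.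
right; exists e => //; apply: weight_neq0 => l ul; split.
  by apply: (subsetP sA); rewrite inE; apply/margins_row_gt0; exists l.
by apply: (subsetP sB); rewrite inE; apply/margins_col_gt0; exists l.
Qed.

(** All monomials of margins d agree up to sign, and by [monomial_dichotomy] they
either vanish or are detected by some pattern e; w is the common value of the
quotients of a monomial by its weight, and zero in the first case. *)
Lemma monomials_proportional d : exists e (w : Q),
  (component e \/ w = 0) /\
  forall u, margins u = d -> proj 'X_[u] = proj (weight K e u)%:MP * w.
Proof.
have [[v [e [vd ce wv]]]|none] := pselect (exists v e,
    [/\ margins v = d, component e & weight K e v != 0]).
  exists e, (proj (weight K e v)^-1%:MP * proj 'X_[v]).
  split=> [|u ud]; first by left.
  have [|b [-> ->//]] := @same_margins_weight K _ _ u v; first by rewrite ud vd.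
  rewrite mulrA -projM -mpolyCM mulfK // rmorph_sign -signr_odd oddb.
  by rewrite rmorph_sign.
exists (set0, set0), 0; split=> [|u ud]; first by right.
rewrite mulr0; have [//|[e ce wu]] := monomial_dichotomy u.
by case: none; exists u, e.
Qed.

(** The radical is the intersection of the kernels of the pattern homomorphisms.
Grouping the monomials of f by margins d, the image of f in the quotient is the
sum of (coefficient of [pattern_mor (e d) f] at d) * w d, with e d and w d as in
[monomials_proportional]. *)
Lemma proj_eq0P f : proj f = 0 :> Q <->
  forall e, component e -> pattern_mor e f = 0.
Proof.
split=> [/proj_eq0 If e ce|f0]; first exact: pattern_mor_rad.
have [ee eeP] := choice monomials_proportional.
have [w wP] := choice eeP.
pose D := undup [seq margins u | u <- msupp f].
have -> : proj f = \sum_(d <- D) proj ((pattern_mor (ee d) f)@_d)%:MP * w d.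
  under eq_bigr do rewrite mcoeff_pattern_mor !rmorph_sum mulr_suml.
  rewrite exchange_big [f in LHS]mpolyE [LHS]rmorph_sum big_seq [RHS]big_seq.
  apply: eq_bigr => u uf /=.
  have uD : margins u \in D by rewrite mem_undup map_f.
  rewrite (bigD1_seq _ uD (undup_uniq _)) /= eqxx mulr1 big1 ?addr0 => [|d nd].
    by rewrite -mul_mpolyC projM (proj2 (wP _) u erefl) mulrA -projM mpolyCM.
  by rewrite eq_sym (negPf nd) mulr0 mpolyC0 rmorph0 mul0r.
rewrite big1 // => d _; have [[ce|->] _] := wP d; last by rewrite mulr0.
by rewrite f0 // mcoeff0 mpolyC0 rmorph0 mul0r.
Qed.
End OddCharacteristic.

(** * F-purity *)

Lemma ideal_genP (R : comNzRingType) (s : seq R) x :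
  ideal_gen s x <-> exists a : nat -> R, x = \sum_(i < size s) a i * s`_i.
Proof.
split=> [[a ->]|[a ->]]; last by exists (fun i => a i).
exists (fun i => if insub i is Some j then a j else 0).
by apply: eq_bigr => i _; rewrite valK.
Qed.

Lemma frobenius_powerP p (R : comNzRingType) (s : seq R) e x :
  frobenius_power p s e x <->
  exists a : nat -> R, x = \sum_(i < size s) a i * s`_i ^+ (p ^ e).
Proof.
rewrite /frobenius_power ideal_genP size_map.
by split=> [] [a ->]; exists a; apply: eq_bigr => i _; rewrite (nth_map 0).
Qed.

Lemma ideal_frobenius_power p (R : comNzRingType) (s : seq R) e x :
  p \in [pchar R] -> ideal_gen s x -> frobenius_power p s e (x ^+ (p ^ e)).
Proof.
move=> charR /ideal_genP[a ->]; apply/frobenius_powerP.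
exists (fun i => a i ^+ (p ^ e)); rewrite -/(frob e charR _) rmorph_sum.
by apply: eq_bigr => i _; rewrite rmorphM.
Qed.

Section MarginsScaling.
Variables (m n q : nat).

Lemma marginsMn (u : 'X_{1..m * n}) : margins (u *+ q) = (margins u *+ q)%MM.
Proof.
apply/mnmP => i; rewrite mulmnE !mnm_sumE big_distrl; apply: eq_bigr => l _ /=.
by rewrite !mulmnE mulnA.
Qed.

Lemma balanced_cancel (d alpha : 'X_{1..m + n}) : (0 < q)%N ->
  balanced alpha -> balanced (d *+ q + alpha)%MM -> balanced d.
Proof.
move=> q_gt0 /eqP bal_alpha; rewrite /balanced.
under eq_bigr do rewrite mnmDE mulmnE.
under [X in _ == X]eq_bigr do rewrite mnmDE mulmnE.
by rewrite !big_split /= bal_alpha eqn_add2r -!big_distrl eqn_pmul2r.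
Qed.
End MarginsScaling.

Section FrobeniusDescent.
Variables (K : fieldType) (p m n : nat).
Hypotheses (charK : p \in [pchar K]) (p_gt2 : (2 < p)%N).
Hypotheses (m_ge2 : (2 <= m)%N) (n_ge2 : (2 <= n)%N).
Local Notation S := {mpoly K[m * n]}.
Local Notation Q := (P2_quotient K m n).

Lemma weight_rmorph (F : {rmorphism K -> K}) e (u : 'X_{1..m * n}) :
  F (weight K e u) = weight K e u.
Proof.
rewrite rmorph_prod; apply: eq_bigr => l _.
by rewrite rmorphXn sign_pattern_rmorph.
Qed.

(** Comparing coefficients for all patterns and exponents gives a linear system
in the coefficients of the multipliers, to which [field_descent] applies; the
signs of the patterns are fixed by F. *)
Lemma coefficient_descent (F : {rmorphism K -> K}) (x : S) N (a g : nat -> S) :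
    (forall e, component e -> map_mpoly F (pattern_mor e x) =
       \sum_(i < N) pattern_mor e (a i) * map_mpoly F (pattern_mor e (g i))) ->
  exists b : nat -> S, proj x = \sum_(i < N) proj (b i) * proj (g i).
Proof.
move=> xE; pose bd := (\max_(i < N) msize (a i))%N.
pose T : Type :=
  ({e : {set 'I_m} * {set 'I_n} | component e} * 'X_{1..m + n})%type.
pose J := ('I_N * bmultinom (m * n) bd)%type.
pose v (j : J) (t : T) := (pattern_mor (sval t.1) ('X_[bmnm j.2] * g j.1))@_t.2.
pose r (t : T) := (pattern_mor (sval t.1) x)@_t.2.
have [|d dE] := @field_descent_fin _ _ F T _ v r (fun j => (a j.1)@_(bmnm j.2)).
  move=> [[e ce] t]; rewrite /r /v /= -mcoeff_map_mpoly xE // raddf_sum.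
  rewrite -(pair_bigA _ (fun (i : 'I_N) (u : bmultinom (m * n) bd) => (a i)@_u *
    F (pattern_mor e ('X_[u] * g i))@_t)) /=.
  apply: eq_bigr => i _.
  rewrite [in pattern_mor e (a i)](@mpolywE _ _ bd (a i)); last first.
    exact: (@leq_bigmax _ (fun i : 'I_N => msize (a i)) i).
  rewrite pattern_mor_sum mulr_suml raddf_sum; apply: eq_bigr => u _ /=.
  rewrite pattern_morZ -scalerAl mcoeffZ -mcoeff_map_mpoly; congr (_ * _@__).
  rewrite pattern_morM rmorphM /= !pattern_morX map_mpolyZ map_mpolyX.
  by rewrite weight_rmorph.
pose b i := if insub i is Some i' then
  \sum_(u : bmultinom (m * n) bd) d (i', u) *: 'X_[u] else 0 : S.
exists b; apply/eqP; rewrite -subr_eq0; apply/eqP.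
have -> : proj x - \sum_(i < N) proj (b i) * proj (g i) =
    proj (x - \sum_(i < N) b i * g i).
  rewrite projB; congr (_ - _); rewrite [RHS]rmorph_sum.
  by apply: eq_bigr => i _; rewrite -projM.
apply/(proj_eq0P charK p_gt2 m_ge2 n_ge2) => e ce.
rewrite pattern_morB; apply/eqP; rewrite subr_eq0; apply/eqP/mpolyP => t.
have /= := dE (exist _ e ce, t); rewrite /r /v /= => ->.
rewrite pattern_mor_sum raddf_sum.
rewrite (eq_bigr (fun j => d (j.1, j.2) *
    (pattern_mor e ('X_[bmnm j.2] * g j.1))@_t)); last by case.
rewrite -(pair_bigA _ (fun i u => d (i, u) *
    (pattern_mor e ('X_[bmnm u] * g i))@_t)) /=.
apply: eq_bigr => i _; rewrite /b valK mulr_suml pattern_mor_sum raddf_sum.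
by apply: eq_bigr => u _; rewrite /= -scalerAl pattern_morZ mcoeffZ.
Qed.

(** The operator sends an exponent q d + alpha to d, and d is balanced as soon
as alpha is, so a monomial goes to a multiple of a monomial of margins d.  The
proportionality assumption lets the same scalar serve all patterns. *)
Lemma trace_lift q alpha : (0 < q)%N -> balanced alpha ->
    (forall u v, margins u = (margins v *+ q + alpha)%MM ->
      exists c, forall e, component e -> weight K e u = c * weight K e v) ->
  forall a : S, exists a' : S, forall e, component e ->
    cartier q alpha (pattern_mor e a) = pattern_mor e a'.
Proof.
move=> q_gt0 bal_alpha prop a.
have monomial_lift u : exists a' : S, forall e, component e ->
    cartier q alpha (pattern_mor e 'X_[u]) = pattern_mor e a'.
  have [[d ud]|none] := pselect (exists d, margins u = d *+ q + alpha)%MM.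
    have [v dv] : exists v, d = margins v.
      apply: balanced_is_margins; apply: (balanced_cancel q_gt0 bal_alpha).
      by rewrite -ud balanced_margins.
    have [|c cP] := prop u v; first by rewrite ud dv.
    exists (c *: 'X_[v]) => e ce.
    rewrite pattern_morZ !pattern_morX cartierZ // cP // ud cartierX // dv.
    by rewrite scalerA.
  exists 0 => e ce; rewrite pattern_morX cartierZ // cartierX_eq0 //.
    by rewrite scaler0 /pattern_mor raddf0.
  by move=> d ud; apply: none; exists d.
have [h hP] := choice monomial_lift.
exists (\sum_(u <- msupp a) a@_u *: h u) => e ce.
rewrite {1}[a]mpolyE !pattern_mor_sum cartier_sum //; apply: eq_bigr => u _.
by rewrite !pattern_morZ cartierZ // hP.
Qed.

Lemma proj_eqP (f g : S) : proj f = proj g <->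
  forall e, component e -> pattern_mor e f = pattern_mor e g.
Proof.
split=> [fg e ce|fg]; last first.
  apply/eqP; rewrite -subr_eq0 -projB; apply/eqP.
  apply/(proj_eq0P charK p_gt2 m_ge2 n_ge2) => e ce.
  by rewrite pattern_morB fg // subrr.
apply/eqP; rewrite -subr_eq0 -pattern_morB; apply/eqP.
have [-> //] := proj_eq0P charK p_gt2 m_ge2 n_ge2 (f - g).
by rewrite projB fg subrr.
Qed.

(** The common part of F-purity (with c = 1 and alpha = 0) and of F-regularity
(with alpha an exponent of c): a relation on q-th powers, whose left factor c
becomes a constant at alpha, descends to a relation on the elements. *)
Lemma frobenius_contraction e0 (alpha : 'X_{1..m + n}) (c0 : K) (c x : S) N
    (a g : nat -> S) :
    let q := (p ^ e0)%N in
    (forall i, alpha i < q)%N ->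
    (forall a : S, exists a' : S, forall e, component e ->
      cartier q alpha (pattern_mor e a) = pattern_mor e a') ->
    c0 != 0 ->
    (forall e, component e -> cartier q alpha (pattern_mor e c) = c0%:MP) ->
    proj c * proj x ^+ q = \sum_(i < N) proj (a i) * proj (g i) ^+ q ->
  exists b : nat -> S, proj x = \sum_(i < N) proj (b i) * proj (g i).
Proof.
move=> q alpha_lt lift c0_neq0 cE rel.
have [h hP] := choice lift.
apply: (@coefficient_descent (frob e0 charK) x N (fun i => c0^-1 *: h (a i)) g).
move=> e ce; have : proj (c * x ^+ q) = proj (\sum_(i < N) a i * g i ^+ q).
  rewrite projM [proj (x ^+ q)]rmorphXn rel [RHS]rmorph_sum.
  by apply: eq_bigr => i _; rewrite /= projM [proj (_ ^+ q)]rmorphXn.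
move/proj_eqP => /(_ e ce)/(congr1 (cartier q alpha)).
have q_gt0 : (0 < q)%N by rewrite expn_gt0 prime_gt0 ?(pcharf_prime charK).
rewrite pattern_morM pattern_mor_exp (cartierM charK) // cE // pattern_mor_sum.
rewrite cartier_sum // mul_mpolyC => /(congr1 (GRing.scale c0^-1)).
rewrite scalerA mulVf // scale1r => ->; rewrite scaler_sumr.
apply: eq_bigr => i _; rewrite pattern_morM pattern_mor_exp (cartierM charK) //.
by rewrite hP // pattern_morZ scalerAl.
Qed.

Lemma quotient_pchar : p \in [pchar Q].
Proof. exact: (rmorph_pchar (@proj K m n)) (mpoly_pchar _ charK). Qed.

Lemma lift_seq (s : seq Q) : exists g : nat -> S, forall i, s`_i = proj (g i).
Proof. by exists (fun i => repr s`_i) => i; rewrite /proj reprK. Qed.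

Lemma P2_quotient_F_pure : F_pure p Q.
Proof.
move=> s x; split=> [sx|[e0 e0_gt0 /frobenius_powerP[a xE]]].
  by exists 1%N => //; apply: ideal_frobenius_power => //;
    apply: quotient_pchar.
have q_gt0 : (0 < p ^ e0)%N by rewrite expn_gt0 prime_gt0 ?(pcharf_prime charK).
have [[fx xx] [g gE]] := (proj_surj x, lift_seq s).
have [fa aE] := choice (fun i => proj_surj (a i)).
have [|||||b bE] := @frobenius_contraction e0 0%MM 1 1 fx (size s) fa g.
- by move=> i; rewrite mnm0E.
- apply: trace_lift => // [|u v].
    by rewrite /balanced !big1 // => i _; rewrite mnm0E.
  rewrite addm0 -marginsMn => uv.
  have [b [_ bE]] := @same_margins_weight K _ _ _ _ uv.
  exists ((-1) ^+ b) => e ce; rewrite bE //; congr (_ * _).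
  rewrite -[RHS](weight_rmorph (frob e0 charK)) /= /frob -prodrXl.
  by apply: eq_bigr => l _; rewrite mulmnE exprM.
- exact: oner_neq0.
- move=> e ce; rewrite [pattern_mor e 1]rmorph1 (cartier_const charK).
    by rewrite mcoeff1 ?eqxx //.
  by rewrite msize1.
- rewrite [proj 1]rmorph1 mul1r -xx xE; apply: eq_bigr => i _.
  by rewrite gE aE.
apply/ideal_genP; exists (fun i => proj (b i)); rewrite xx bE.
by apply: eq_bigr => i _; rewrite /= gE.
Qed.
End FrobeniusDescent.

(** * F-regularity *)

Section TwoByTwo.
Variables (K : fieldType) (p m n : nat).
Hypotheses (charK : p \in [pchar K]) (p_gt2 : (2 < p)%N).
Hypotheses (m2 : m = 2%N) (n2 : n = 2%N).
Local Notation S := {mpoly K[m * n]}.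
Local Notation Q := (P2_quotient K m n).

Let full : {set 'I_m} * {set 'I_n} := (setT, setT).

Let component_full : component full.
Proof. by rewrite /component !cardsT !card_ord m2 n2. Qed.

(** A block contains no other pattern. *)
Let only_full e : component e -> e = full.
Proof.
move=> ce; have [sA sB] := (subsetT e.1, subsetT e.2).
apply: component_antichain => //; right.
by rewrite cardsT card_ord.
Qed.

Let weight_full_neq0 u : weight K full u != 0.
Proof. by apply: weight_neq0 => l _; rewrite !inE. Qed.

Lemma P2_quotient_F_regular_2x2 : F_regular p Q.
Proof.
have [m_ge2 n_ge2] : (2 <= m)%N /\ (2 <= n)%N by rewrite m2 n2.
have p_gt1 : (1 < p)%N by apply: ltnW.
move=> s x; split=> [sx|[c c_reg [e1 xE]]].
  exists 1; first exact: lreg1.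
  exists 0%N => e _ _; rewrite mul1r; apply: ideal_frobenius_power => //.
  exact: quotient_pchar.
have [[[fx xx] [fc cc]] [g gE]] := (proj_surj x, proj_surj c, lift_seq s).
have fc_neq0 : pattern_mor full fc != 0.
  apply/eqP => fc0; have c0 : c = 0.
    rewrite cc; apply/(proj_eq0P charK p_gt2 m_ge2 n_ge2) => e ce.
    by rewrite (only_full ce).
  have /eqP := c_reg 1 0 (etrans (mulr1 c) (etrans c0 (esym (mulr0 c)))).
  by rewrite oner_eq0.
(* Beyond the threshold e1, and with q above the degree of c. *)
set e0 := maxn e1 (msize (pattern_mor full fc)).+1.
have lt_size : (msize (pattern_mor full fc) < p ^ e0)%N.
  by apply: (leq_trans _ (ltnW (ltn_expl e0 p_gt1))); rewrite leq_maxr.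
have /frobenius_powerP[a aE] : frobenius_power p s e0 (c * x ^+ (p ^ e0)).
  by apply: xE; rewrite ?leq_maxl // leq_max orbT.
have [fa faE] := choice (fun i => proj_surj (a i)).
pose alpha := mlead (pattern_mor full fc).
have alpha_supp : alpha \in msupp (pattern_mor full fc) by apply: mlead_supp.
have alpha_lt i : (alpha i < p ^ e0)%N.
  apply: leq_ltn_trans (ltn_trans (msize_mdeg_lt alpha_supp) lt_size).
  by rewrite mdegE (bigD1 i) //= leq_addr.
have bal_alpha : balanced alpha.
  have [[u <-]|none] := pselect (exists u, margins u = alpha).
    exact: balanced_margins.
  move: alpha_supp; rewrite mcoeff_msupp mcoeff_pattern_mor.
  rewrite big1 ?eqxx // => u _.
  by case: eqP => [ua|_]; [case: none; exists u | rewrite mulr0].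
have [||||b bE] := @frobenius_contraction K p m n charK p_gt2 m_ge2
    n_ge2 e0 alpha (pattern_mor full fc)@_alpha fc fx (size s) fa g alpha_lt.
- apply: trace_lift => // [|u v _].
    exact: leq_ltn_trans (leq0n _) lt_size.
  exists (weight K full u / weight K full v) => e ce.
  by rewrite (only_full ce) divfK.
- by rewrite -mcoeff_msupp.
- by move=> e ce; rewrite (only_full ce) (cartier_const charK) // ltnW.
- by rewrite -cc -xx aE; apply: eq_bigr => i _; rewrite gE faE.
apply/ideal_genP; exists (fun i => proj (b i)); rewrite xx bE.
by apply: eq_bigr => i _; rewrite /= gE.
Qed.
End TwoByTwo.

Section Reducible.
Variables (K : fieldType) (p m n : nat).
Hypotheses (charK : p \in [pchar K]) (p_gt2 : (2 < p)%N).
Hypotheses (m_ge2 : (2 <= m)%N) (n_ge2 : (2 <= n)%N).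
Local Notation S := {mpoly K[m * n]}.
Local Notation Q := (P2_quotient K m n).

Lemma component_gt0 e : @component m n e -> (0 < #|e.1|)%N /\ (0 < #|e.2|)%N.
Proof. by rewrite /component; lia. Qed.

Lemma cell_margins_inj : injective (@cell_margins m n).
Proof.
move=> l l' /mnmP E; rewrite -[l]index_cell -[l']index_cell.
have := E (rshift m (cell l).2); have := E (lshift n (cell l).1).
rewrite /cell_margins !mnmDE !mnm1E !eq_lshift !eq_rshift eq_rlshift eq_lrshift.
rewrite !eq_rlshift !eq_lrshift !eqxx addn0 add0n addn0.
by case: eqP => [->|//] _; case: eqP => [->|].
Qed.

Variables (i0 i1 : 'I_m) (j0 j1 : 'I_n).
Hypotheses (ni : i0 != i1) (nj : j0 != j1).
Let e0 : {set 'I_m} * {set 'I_n} := ([set i0; i1], [set j0; j1]).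

Let card_e0 : #|e0.1| = 2%N /\ #|e0.2| = 2%N.
Proof. by rewrite !cards2 ni nj. Qed.

Let component_e0 : component e0.
Proof. by rewrite /component card_e0.1 card_e0.2. Qed.

Definition block_mon : S := 'X_(mxvec_index i0 j0) * 'X_(mxvec_index i1 j1).

Definition off_block : S :=
  \sum_(l | ~~ (((cell l).1 \in e0.1) && ((cell l).2 \in e0.2))) 'X_l.

(** A pattern on which the monomial survives contains the block. *)
Lemma block_mon_eq0 e : component e ->
  (pattern_mor e block_mon == 0) = (e != e0).
Proof.
move=> ce; have XN0 l : 'X_[cell_margins l] != 0 :> {mpoly K[m + n]}.
  by rewrite -msupp_eq0 msuppX.
rewrite pattern_morM !pattern_morU !cell_index mulf_eq0
  !scaler_eq0 !(negPf (XN0 _)).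
rewrite !orbF -[_ || _]negbK negb_or !sign_pattern_neq0; congr (~~ _).
apply/idP/eqP => [/andP[/andP[i0e j0e] /andP[i1e j1e]]|->];
  last by rewrite !inE !eqxx !orbT.
apply/esym/component_antichain => //; last by left; case: card_e0.
  by apply/subsetP => i; rewrite !inE => /orP[] /eqP->.
by apply/subsetP => i; rewrite !inE => /orP[] /eqP->.
Qed.

(** Distinct entries have distinct monomials as images, so the vanishing of the
linear form on a pattern means that the pattern lies inside the block. *)
Lemma off_block_eq0 e : component e ->
  (pattern_mor e off_block == 0) = (e == e0).
Proof.
move=> ce; rewrite pattern_mor_sum; apply/eqP/eqP => [y0|->]; last first.
  apply: big1 => l off; rewrite pattern_morU.
  suff /eqP-> : sign_pattern K e0 (cell l).1 (cell l).2 == 0 by rewrite scale0r.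
  by rewrite -[_ == _]negbK sign_pattern_neq0.
have inside i j : i \in e.1 -> j \in e.2 -> (i \in e0.1) && (j \in e0.2).
  move=> ie je; apply: contraPT y0 => off /eqP; apply/negP.
  pose l := mxvec_index i j; have posl : cell l = (i, j) by rewrite cell_index.
  apply/eqP => /(congr1 (mcoeff (cell_margins l))); rewrite raddf_sum mcoeff0.
  rewrite (bigD1 l) /=; last by rewrite posl.
  rewrite pattern_morU mcoeffZ mcoeffX eqxx mulr1 big1 ?addr0
    => [|l' /andP[_ nl]].
    by move/eqP; apply/negP; rewrite posl sign_pattern_neq0 ie je.
  rewrite pattern_morU mcoeffZ mcoeffX (inj_eq cell_margins_inj) (negPf nl).
  by rewrite mulr0.
have [/card_gt0P[i ie] /card_gt0P[j je]] := component_gt0 ce.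
apply: component_antichain => //; last by right; case: card_e0.
  by apply/subsetP => i' ie'; case/andP: (inside _ _ ie' je).
by apply/subsetP => j' je'; case/andP: (inside _ _ ie je').
Qed.

Let x := proj block_mon.
Let y := proj off_block.

Lemma block_off_block_mul0 : x * y = 0.
Proof.
rewrite -projM; apply/(proj_eq0P charK p_gt2 m_ge2 n_ge2) => e ce.
apply/eqP; rewrite pattern_morM mulf_eq0 block_mon_eq0 // off_block_eq0 //.
exact: orNb.
Qed.

Lemma pattern_mor_sum_neq0 e : component e ->
  pattern_mor e (block_mon + off_block) != 0.
Proof.
move=> ce; rewrite pattern_morD.
have := block_mon_eq0 ce; have := off_block_eq0 ce.
case: (eqVneq e e0) => _ /= E1 E2.
  by rewrite (eqP E1) addr0 E2.
by rewrite (eqP E2) add0r E1.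
Qed.

Lemma sum_lreg : GRing.lreg (x + y).
Proof.
move=> a b ab; apply/eqP; rewrite -subr_eq0; apply/eqP.
have [h hE] := proj_surj (a - b); rewrite hE.
apply/(proj_eq0P charK p_gt2 m_ge2 n_ge2) => e ce.
have : proj ((block_mon + off_block) * h) = 0.
  by rewrite projM [proj (_ + _)]rmorphD -hE mulrBr ab subrr.
move/(proj_eq0P charK p_gt2 m_ge2 n_ge2)/(_ e ce)/eqP.
by rewrite pattern_morM mulf_eq0 (negPf (pattern_mor_sum_neq0 ce)) => /eqP.
Qed.

(** As x y = 0, both (x + y) x^q and x (x + y)^q equal x^(q+1). *)
Lemma block_tight_closure : tight_closure p [:: x + y] x.
Proof.
exists (x + y); first exact: sum_lreg.
exists 0%N => e _ _; apply/frobenius_powerP; exists (fun=> x).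
have charQ : p \in [pchar Q] by apply: quotient_pchar.
have q_gt0 : (0 < p ^ e)%N by rewrite expn_gt0 prime_gt0 ?(pcharf_prime charK).
rewrite big_ord1 /= -/(frob e charQ (x + y)) rmorphD /= /frob.
rewrite -(prednK q_gt0) !exprS mulrDl mulrDr.
by rewrite !mulrA [y * x]mulrC block_off_block_mul0 !mul0r.
Qed.

(** A multiplier r would have the constant term 1 by its value on the block, and
0 by its value on e. *)
Lemma block_notin_ideal e : component e -> e != e0 -> ~ ideal_gen [:: x + y] x.
Proof.
move=> ce ne /ideal_genP[a]; rewrite big_ord1 /=.
have [r ->] := proj_surj (a 0%N).
rewrite -[_ + y]rmorphD -projM => /(proj_eqP charK p_gt2 m_ge2 n_ge2) E.
have := E e ce; have := E e0 component_e0.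
rewrite !(pattern_morM _ r) !pattern_morD.
have [/eqP-> /eqP->] :
    pattern_mor e block_mon == 0 /\ pattern_mor e0 off_block == 0.
  by rewrite block_mon_eq0 // off_block_eq0 // ne.
rewrite addr0 add0r => E0 /esym/eqP.
rewrite mulf_eq0 off_block_eq0 // (negPf ne) orbF.
move=> /eqP r0; have r1 : pattern_mor e0 r = 1.
  apply: (@mulIf _ (pattern_mor e0 block_mon)); last by rewrite mul1r.
  by rewrite block_mon_eq0 // eqxx.
have := pattern_mor0 e r; rewrite -(pattern_mor0 e0 r) r0 r1 meval0 meval1.
by move/esym/eqP; rewrite oner_eq0.
Qed.
End Reducible.

Lemma P2_quotient_not_F_regular (K : fieldType) (p m n : nat) :
    p \in [pchar K] -> (2 < p)%N -> (2 <= m)%N -> (2 <= n)%N ->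
    (2 < m)%N || (2 < n)%N ->
  ~ F_regular p (P2_quotient K m n).
Proof.
move=> charK p_gt2 m_ge2 n_ge2 big_mn reg.
pose i0 := Ordinal (ltnW m_ge2); pose i1 := Ordinal m_ge2.
pose j0 := Ordinal (ltnW n_ge2); pose j1 := Ordinal n_ge2.
have [e [ce ne]] : exists e, component e /\ e != ([set i0; i1], [set j0; j1]).
  case/orP: big_mn => lt2.
    exists (setT, [set j0]); rewrite /component cardsT card_ord cards1 lt2.
    rewrite !orbT; split=> //.
    apply/eqP => -[_ /(congr1 (fun A => #|pred_of_set A|))].
    by rewrite cards1 cards2.
  exists ([set i0], setT); rewrite /component cardsT card_ord cards1 lt2.
  rewrite !orbT; split=> //.
  apply/eqP => -[/(congr1 (fun A => #|pred_of_set A|))].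
  by rewrite cards1 cards2.
apply: (@block_notin_ideal K p m n charK p_gt2 m_ge2 n_ge2
          i0 i1 j0 j1 _ _ e ce ne) => //.
by apply/reg; apply: block_tight_closure.
Qed.

Theorem theorem1p2 (k : fieldType) (p m n : nat)
    (char_k : p \in [pchar k]%R) (p_gt2 : (2 < p)%N)
    (m_ge2 : (2 <= m)%N) (n_ge2 : (2 <= n)%N) :
  F_pure p (P2_quotient k m n) /\
  (F_regular p (P2_quotient k m n) <-> m = 2%N /\ n = 2%N).
Proof.
split; first exact: P2_quotient_F_pure.
split=> [reg|[m2 n2]]; last exact: P2_quotient_F_regular_2x2.
have [big_mn|] := boolP ((2 < m)%N || (2 < n)%N).
  by case: (P2_quotient_not_F_regular char_k p_gt2 m_ge2 n_ge2 big_mn).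
rewrite negb_or -!leqNgt => /andP[m_le2 n_le2].
by split; apply/eqP; rewrite eqn_leq ?m_le2 ?n_le2.
Qed.
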